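(* Let $A_1, A_2\in\mathbb{R}^{n\times n}$ be Schur stable matrices and for $\alpha\in[0,1]$ let $C(\alpha)=\alpha A_1+(1-\alpha)A_2$. Let $d=n(n-1)/2$ and, with $\cdot$ denoting the bialternate product and $I_d$ the $d\times d$ identity matrix, put $$F_0=I_d-A_2\cdot A_2,\qquad F_1=-2(A_1\cdot A_2-A_2\cdot A_2),\qquad F_2=-(A_1\cdot A_1+A_2\cdot A_2-2A_2\cdot A_1),$$ $$M=\begin{bmatrix}0 & I_d \\ -F_0^{-1}F_2 & -F_0^{-1}F_1\end{bmatrix}\in\mathbb{R}^{2d\times 2d}.$$ Then $C(\alpha)$ is Schur stable for all $\alpha\in[0,1]$ if and only if both of the following hold: (i) $(I-A_1)(I-A_2)^{-1}$ and $(I+A_1)(I+A_2)^{-1}$ have no negative real eigenvalue; (ii) $M$ has no real eigenvalue in $[1,\infty)$.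
   Context: A real $n\times n$ matrix is Schur stable if all its (complex) eigenvalues lie in the open unit disk. $I$ is the $n\times n$ identity matrix. Bialternate product: for $A=[a_{ij}],B=[b_{ij}]\in\mathbb{R}^{n\times n}$, $A\cdot B$ is the $d\times d$ matrix, $d=n(n-1)/2$, with rows and columns indexed (in a fixed order) by the pairs $(p,q)$ with $1\le p<q\le n$, whose entry in row $(i,j)$ and column $(k,l)$ is $$f_{ij,kl}=\frac12\left(\begin{vmatrix} a_{ik} & a_{il} \\ b_{jk} & b_{jl} \end{vmatrix}+\begin{vmatrix} b_{ik} & b_{il} \\ a_{jk} & a_{jl} \end{vmatrix}\right).$$ When $A_2$ is Schur stable, $F_0$ is invertible, since the eigenvalues of $A_2\cdot A_2$ are the products $\lambda_i\lambda_j$ ($i<j$) of the eigenvalues $\lambda_1,\dots,\lambda_n$ of $A_2$. *)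

(* Defs.v *)
From HB Require Import structures.
From mathcomp Require Import all_boot all_order all_algebra.
From mathcomp Require Import complex reals.

Set Implicit Arguments.
Unset Strict Implicit.
Unset Printing Implicit Defensive.

Import Order.TTheory GRing.Theory Num.Theory.
Local Open Scope ring_scope.

Definition schur_stable (R : realType) (n : nat) (A : 'M[R]_n) : Prop :=
  forall z : R[i], eigenvalue (map_mx (real_complex R) A) z -> `|z| < 1.

Definition ltpairs (n : nat) : {set 'I_n * 'I_n} :=
  [set p : 'I_n * 'I_n | (p.1 < p.2)%N].

Definition bialt_dim (n : nat) : nat := ((n * (n - 1)) %/ 2)%N.

Lemma card_ltpairs (n : nat) : #|ltpairs n| = bialt_dim n.
Proof.
rewrite /bialt_dim subn1 divn2 -bin2 -bin2_sum -sum1_card big_mkord.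
under eq_bigl do rewrite inE.
rewrite -(pair_big_dep xpredT (fun i j : 'I_n => (i < j)%N) (fun _ _ => 1%N)) /=.
rewrite (exchange_big_dep xpredT) //=; apply: eq_bigr => j _.
by rewrite -(big_ord_widen n (fun=> 1%N) (ltnW (ltn_ord j))) sum1_card card_ord.
Qed.

(* The enumeration of ['I_n * 'I_n] is lexicographic, hence so is this indexing
   of the pairs [(p, q)], [p < q], by ['I_(n(n-1)/2)]. *)
Definition ltpair (n : nat) (r : 'I_(bialt_dim n)) : 'I_n * 'I_n :=
  enum_val (cast_ord (esym (card_ltpairs n)) r).

Definition det2 (R : fieldType) (a b c d : R) : R := a * d - b * c.

Definition bialternate (R : fieldType) (n : nat) (A B : 'M[R]_n) :
    'M[R]_(bialt_dim n) :=
  \matrix_(r < bialt_dim n, c < bialt_dim n)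
    let: (i, j) := ltpair r in
    let: (k, l) := ltpair c in
    2%:R^-1 * (det2 (A i k) (A i l)
                    (B j k) (B j l) +
               det2 (B i k) (B i l)
                    (A j k) (A j l)).

Definition segF0 (R : fieldType) (n : nat) (A2 : 'M[R]_n) :
    'M[R]_(bialt_dim n) :=
  1%:M - bialternate A2 A2.

Definition segF1 (R : fieldType) (n : nat) (A1 A2 : 'M[R]_n) :
    'M[R]_(bialt_dim n) :=
  - (2%:R *: (bialternate A1 A2 - bialternate A2 A2)).

Definition segF2 (R : fieldType) (n : nat) (A1 A2 : 'M[R]_n) :
    'M[R]_(bialt_dim n) :=
  - (bialternate A1 A1 + bialternate A2 A2 - 2%:R *: bialternate A2 A1).

(* [invmx] is total; [segF0 A2] is invertible whenever [A2] is Schur stable. *)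
Definition segM (R : fieldType) (n : nat) (A1 A2 : 'M[R]_n) :
    'M[R]_(bialt_dim n + bialt_dim n) :=
  block_mx 0 1%:M
           (- (invmx (segF0 A2) *m segF2 A1 A2))
           (- (invmx (segF0 A2) *m segF1 A1 A2)).

(* Main.v *)
(* If stability fails somewhere on the segment, then by continuity of the
   characteristic polynomial some [C(a)] has an eigenvalue [z] on the unit circle.
   Either [z = 1] or [z = -1], which after rescaling the pencil
   [(I -+ A1) - x (I -+ A2)] is a negative eigenvalue in (i), or [z] and its
   conjugate are distinct and [1] is an eigenvalue of [C(a) . C(a)]; as
   [I - C(a) . C(a) = F0 + a F1 + a^2 F2], the latter says that [1 / a] is an
   eigenvalue of the companion matrix [M]. Conversely, a vector fixed by
   [C . C] is an alternating matrix [X] with [C^T X C = X], and this Stein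
   equation has only the zero solution when [C] is Schur stable. *)
From HB Require Import structures.
Require Import Defs.
From mathcomp Require Import all_boot all_order all_algebra.
From mathcomp Require Import complex reals polyrcf ring.

Set Implicit Arguments.
Unset Strict Implicit.
Unset Printing Implicit Defensive.

Import Order.TTheory GRing.Theory Num.Theory.
Local Open Scope ring_scope.

(** * Sums and injectivity for the indexing by pairs *)

Lemma big_ltpair (V : nmodType) (n : nat) (F : 'I_n -> 'I_n -> V) :
  \sum_(r < bialt_dim n) F (ltpair r).1 (ltpair r).2 =
  \sum_(i < n) \sum_(j < n | (i < j)%N) F i j.
Proof.
rewrite (pair_big_dep xpredT (fun i j : 'I_n => (i < j)%N)) /=.
rewrite (eq_bigl [in ltpairs n]); last by move=> p; rewrite !inE.
rewrite [RHS]big_enum_val [RHS](reindex (cast_ord (esym (card_ltpairs n)))) /=.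
  by [].
by exists (cast_ord (card_ltpairs n)) => i _; rewrite ?cast_ordK ?cast_ordKV.
Qed.

Lemma ltpair_lt (n : nat) (r : 'I_(bialt_dim n)) :
  ((ltpair r).1 < (ltpair r).2)%N.
Proof. by have := enum_valP (cast_ord (esym (card_ltpairs n)) r); rewrite inE. Qed.

Lemma ltpair_inj (n : nat) : injective (@ltpair n).
Proof. by move=> r s /enum_val_inj /cast_ord_inj. Qed.

Lemma big_square_lt (V : nmodType) (n : nat) (F : 'I_n -> 'I_n -> V) :
  (forall i, F i i = 0) ->
  \sum_i \sum_j F i j = \sum_(i < n) \sum_(j < n | (i < j)%N) (F i j + F j i).
Proof.
move=> F0.
under [RHS]eq_bigr do rewrite big_split.
rewrite big_split /= [X in _ + X](exchange_big_dep xpredT) //= -big_split /=.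
apply: eq_bigr => i _; rewrite (bigID (fun j : 'I_n => (i < j)%N)) /=; congr (_ + _).
rewrite (bigD1 i) ?ltnn //= F0 add0r; apply: eq_bigl => j.
by rewrite -leqNgt ltn_neqAle andbC.
Qed.

(** * Alternating matrices and the bialternate square *)

Section Skew.
Variables (F : fieldType) (n : nat).
Implicit Types (X C : 'M[F]_n) (w : 'rV[F]_(bialt_dim n)).

(** The zero diagonal is a separate condition because in characteristic 2 it does not follow from
    [X^T = - X]. *)
Definition alternating_mx X := X^T = - X /\ forall i, X i i = 0.

Definition ltpair_row X : 'rV[F]_(bialt_dim n) :=
  \row_r X (ltpair r).1 (ltpair r).2.

Fact ltpair_row_is_linear : linear ltpair_row.
Proof. by move=> a X Y; apply/rowP => r; rewrite !mxE. Qed.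
HB.instance Definition _ :=
  GRing.isLinear.Build F 'M[F]_n 'rV[F]_(bialt_dim n) _ ltpair_row
    ltpair_row_is_linear.

(** At most one term of the sum survives, since at most one of [(i, j)] and [(j, i)] is an indexed
    pair; this avoids inverting [ltpair]. *)
Definition mx_of_ltpair_row w : 'M[F]_n :=
  \matrix_(i, j) \sum_r w 0 r *
    ((ltpair r == (i, j))%:R - (ltpair r == (j, i))%:R).

Lemma mx_of_ltpair_row_alternating w : alternating_mx (mx_of_ltpair_row w).
Proof.
split=> [|i]; last by rewrite mxE big1 // => r _; rewrite subrr mulr0.
apply/matrixP => i j; rewrite !mxE -sumrN.
by apply: eq_bigr => r _; rewrite -mulrN opprB.
Qed.

Lemma mx_of_ltpair_rowK : cancel mx_of_ltpair_row ltpair_row.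
Proof.
move=> w; apply/rowP => r; rewrite !mxE (bigD1 r) //= big1 => [|s sr].
  rewrite -surjective_pairing eqxx /= [_ == (_, _)](_ : _ = false) ?subr0 ?mulr1 ?addr0 //.
  apply/negbTE/eqP; have := ltpair_lt r.
  by case: (ltpair r) => i j /= ij [e _]; rewrite e ltnn in ij.
rewrite -surjective_pairing (inj_eq (@ltpair_inj n)) (negbTE sr).
rewrite [_ == (_, _)](_ : _ = false) ?subr0 ?mulr0 //.
apply/negbTE/eqP => e; have := ltpair_lt s; have := ltpair_lt r.
by rewrite e /=; case: ltngtP.
Qed.

Lemma ltpair_row_inj X : alternating_mx X -> ltpair_row X = 0 -> X = 0.
Proof.
move=> [Xs X0] /rowP X_0.
suff P (i j : 'I_n) : (i < j)%N -> X i j = 0.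
  apply/matrixP => i j; rewrite mxE.
  have [/P->//|ji|/val_inj ->//] := ltngtP i j.
  by move/matrixP: Xs => /(_ j i); rewrite !mxE => ->; rewrite P // oppr0.
move=> ij; have ijP : (i, j) \in ltpairs n by rewrite inE.
have := X_0 (cast_ord (card_ltpairs n) (enum_rank_in ijP (i, j))).
by rewrite !mxE /ltpair cast_ordK enum_rankK_in.
Qed.

(* Under the identification of alternating matrices with vectors indexed by the
   pairs [i < j], the bialternate square of [C] is the congruence by [C]. *)
Lemma ltpair_row_bialternate X C : 2%:R != 0 :> F -> alternating_mx X ->
  ltpair_row X *m bialternate C C = ltpair_row (C^T *m X *m C).
Proof.
move=> n2 [Xs X0]; apply/rowP => c; rewrite !mxE.
set k := (ltpair c).1; set l := (ltpair c).2.
(* Folding the term [(i, j)] with [(j, i)], antisymmetry of [X] produces a 2 by 2 minor of [C]. In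
   the bialternate square the two determinants coincide, so the factor 1/2 cancels. *)
transitivity (\sum_i \sum_j C i k * X i j * C j l).
  rewrite big_square_lt => [|i]; last by rewrite X0 mulr0 mul0r.
  rewrite -big_ltpair; apply: eq_bigr => r _; rewrite !mxE.
  rewrite [ltpair r]surjective_pairing [ltpair c]surjective_pairing /= -/k -/l.
  move/matrixP: Xs => /(_ (ltpair r).1 (ltpair r).2); rewrite !mxE => ->.
  by rewrite /det2; field.
rewrite exchange_big; apply: eq_bigr => j _.
rewrite mxE big_distrl /=; apply: eq_bigr => i _.
by rewrite !mxE.
Qed.

Lemma congr_alternating_mx C X : alternating_mx X -> alternating_mx (C^T *m X *m C).
Proof.
move=> [Xs X0]; split=> [|i].
  by rewrite !trmx_mul trmxK Xs mulmxA !mulmxN mulNmx.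
(* The terms [(j, k)] and [(k, j)] of a diagonal entry cancel, in any characteristic. *)
transitivity (\sum_j \sum_k C j i * X j k * C k i).
  rewrite exchange_big mxE; apply: eq_bigr => k _.
  by rewrite mxE big_distrl; apply: eq_bigr => j _; rewrite mxE.
rewrite big_square_lt => [|j]; last by rewrite X0 mulr0 mul0r.
rewrite big1 // => j _; rewrite big1 // => k _.
by move/matrixP: Xs => /(_ j k); rewrite !mxE => ->; ring.
Qed.

Lemma eigenvalue_bialternateP C (z : F) : 2%:R != 0 :> F ->
  reflect (exists X, [/\ alternating_mx X, C^T *m X *m C = z *: X & X != 0])
          (eigenvalue (bialternate C C) z).
Proof.
move=> n2; apply: (iffP eigenvalueP) => [[w wC w0]|[X [Xalt XC X0]]].
  have Xalt := mx_of_ltpair_row_alternating w; have Xw := mx_of_ltpair_rowK w.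
  exists (mx_of_ltpair_row w); move: (mx_of_ltpair_row w) Xalt Xw => X Xalt Xw.
  split=> //; last by apply: contraNneq w0 => X0; rewrite -Xw X0 linear0.
  (* The difference [C^T X C - z X] is itself alternating, so it vanishes as soon as its entries
     above the diagonal do. *)
  apply/eqP; rewrite -subr_eq0; apply/eqP/ltpair_row_inj.
    have [Ys Yd] := congr_alternating_mx C Xalt; have [Xs Xd] := Xalt.
    split=> [|i]; first by rewrite linearB linearZ /= Ys Xs scalerN opprB opprK addrC.
    by rewrite mxE Yd mxE mxE Xd mulr0 subrr.
  by rewrite linearB linearZ /= -ltpair_row_bialternate //= Xw wC subrr.
exists (ltpair_row X).
  by rewrite ltpair_row_bialternate // XC linearZ.
by apply: contraNneq X0 => /ltpair_row_inj ->.
Qed.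

End Skew.

(** * Uniqueness for the Stein equation *)

(** By Cayley-Hamilton a product of factors [C - z] kills [X], and these are peeled off one at a
    time. [X (C - z)] solves the same equation and is killed by the remaining factors, so it is 0 by
    induction. Then [X C = z X], whence [(1 - z D) X = 0] and [X = 0]. *)
Lemma stein_kernel (F : closedFieldType) (n : nat) (C D X : 'M[F]_n) :
  (forall z, eigenvalue C z -> 1%:M - z *: D \in unitmx) ->
  D *m X *m C = X -> X = 0.
Proof.
(* [horner_mx] takes values in a matrix ring, which requires positive size. *)
case: n C D X => [|n] C D X uD; first by move=> _; apply/matrixP => - [].
have [s sE] := closed_field_poly_normal (char_poly C).
rewrite (monicP (char_poly_monic C)) scale1r in sE.
have us z : z \in s -> 1%:M - z *: D \in unitmx.
  by move=> zs; apply: uD; rewrite eigenvalue_root_char sE root_prod_XsubC.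
have : X *m horner_mx C (\prod_(z <- s) ('X - z%:P)) = 0.
  by rewrite -sE Cayley_Hamilton mulmx0.
elim: s us X {sE uD} => [|z s IH] us X; first by rewrite big_nil rmorph1 mulmx1.
rewrite big_cons rmorphM /= rmorphB /= horner_mx_X horner_mx_C mulmxA => XC DXC.
have {XC} : X *m (C - z%:M) = 0.
  apply: IH => //; first by move=> y ys; apply: us; rewrite inE ys orbT.
  rewrite -!mulmxA.
  have -> : (C - z%:M) *m C = C *m (C - z%:M).
    by rewrite mulmxBr mulmxBl scalar_mxC.
  by rewrite !mulmxA DXC.
rewrite mulmxBr mul_mx_scalar => /eqP; rewrite subr_eq0 => /eqP XC.
have e : (1%:M - z *: D) *m X = 0.
  by rewrite mulmxBl mul1mx -scalemxAl scalemxAr -XC mulmxA DXC subrr.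
by rewrite -[X](mulKmx (us z (mem_head _ _))) e mulmx0.
Qed.

Lemma eigenvalueNunitmx (F : fieldType) (n : nat) (A : 'M[F]_n) (a : F) :
  eigenvalue A a = (A - a%:M \notin unitmx).
Proof. by rewrite /eigenvalue /eigenspace kermx_eq0 row_free_unit. Qed.

(** The Stein equation is used over the complex numbers with [D = C^T]. If [1 - z C^T] were singular
    for a nonzero eigenvalue [z] of [C], then [1 / z] would be an eigenvalue too, and both cannot
    have modulus below 1. *)
Lemma schur_stable_bialternate (R : realType) (n : nat) (C : 'M[R]_n) :
  schur_stable C -> ~~ eigenvalue (bialternate C C) 1.
Proof.
move=> sC; have n2 : 2%:R != 0 :> R by rewrite pnatr_eq0.
apply/(eigenvalue_bialternateP _ _ n2) => - [X [_ XC /negP[]]].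
rewrite scale1r in XC; rewrite -(map_mx_eq0 (real_complex R)); apply/eqP.
set f := real_complex R in sC *.
apply: (@stein_kernel _ _ (map_mx f C) (map_mx f C)^T); last first.
  by rewrite matrix.map_trmx -!map_mxM XC.
move=> z zC; rewrite -unitmx_tr linearB linearZ /= trmx1 trmxK.
have [->|z0] := eqVneq z 0; first by rewrite scale0r subr0 unitmx1.
have -> : 1%:M - z *: map_mx f C = (- z) *: (map_mx f C - z^-1%:M).
  by rewrite scalerBr scale_scalar_mx !scaleNr mulNr divff // raddfN opprK addrC.
rewrite unitmxZ ?unitrN ?unitfE // -[_ \in _]negbK -eigenvalueNunitmx.
apply/negP => /sC; rewrite normfV invf_lt1 ?normr_gt0 //.
by move=> /(lt_trans (sC _ zC)); rewrite ltxx.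
Qed.

(** * Eigenvalues of a real matrix on the unit circle *)

Section RealParts.
Variables (R : realType) (n : nat) (C : 'M[R]_n).

Lemma map_Re_mulmx (v : 'rV[R[i]]_n) :
  map_mx (@complex.Re R) (v *m map_mx (real_complex R) C) = map_mx (@complex.Re R) v *m C.
Proof.
apply/rowP => k; rewrite !mxE.
rewrite (big_morph (@complex.Re R) (id1 := 0) (op1 := +%R)) //; last first.
  by case=> ? ? [].
by apply: eq_bigr => j _; rewrite !mxE; case: (v 0 j) => p q /=; ring.
Qed.

Lemma map_Im_mulmx (v : 'rV[R[i]]_n) :
  map_mx (@complex.Im R) (v *m map_mx (real_complex R) C) = map_mx (@complex.Im R) v *m C.
Proof.
apply/rowP => k; rewrite !mxE.
rewrite (big_morph (@complex.Im R) (id1 := 0) (op1 := +%R)) //; last first.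
  by case=> ? ? [].
by apply: eq_bigr => j _; rewrite !mxE; case: (v 0 j) => p q /=; ring.
Qed.

(* If [v = a + i b] is an eigenvector for a nonreal [z], then [a^T b - b^T a] is
   a nonzero alternating matrix that the congruence by [C] multiplies by [|z|^2]. *)
Lemma eigenvalue_unit_circle (z : R[i]) :
  eigenvalue (map_mx (real_complex R) C) z -> `|z| = 1 ->
  [\/ eigenvalue C 1, eigenvalue C (-1) | eigenvalue (bialternate C C) 1].
Proof.
case: z => x y Cz; rewrite normc_def /= => /(congr1 (fun u => complex.Re u ^+ 2)) /=.
rewrite sqr_sqrtr ?addr_ge0 ?sqr_ge0 // expr1n => xy1.
have [y0|y0] := eqVneq y 0.
  move: Cz; rewrite y0 -[(x +i* 0)%C]/(real_complex R x) eigenvalue_map => Cx.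
  move/eqP: xy1; rewrite y0 expr0n addr0 sqrf_eq1 => /orP[] /eqP xE.
    by constructor 1; rewrite -xE.
  by constructor 2; rewrite -xE.
constructor 3; have n2 : 2%:R != 0 :> R by rewrite pnatr_eq0.
have /eigenvalueP[v vC v0] := Cz.
set a := map_mx (@complex.Re R) v; set b := map_mx (@complex.Im R) v.
have aC : a *m C = x *: a - y *: b.
  rewrite -map_Re_mulmx vC; apply/rowP => k; rewrite !mxE.
  by case: (v 0 k) => p q.
have bC : b *m C = x *: b + y *: a.
  rewrite -map_Im_mulmx vC; apply/rowP => k; rewrite !mxE.
  by case: (v 0 k) => p q /=; rewrite addrC.
have ab0 : a = 0 -> b = 0 -> False.
  move=> /rowP a0 /rowP b0; case/negP: v0; apply/eqP/rowP => k.
  by have := a0 k; have := b0 k; rewrite !mxE; case: (v 0 k) => p q /= -> ->.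
clearbody a b.
apply/(eigenvalue_bialternateP _ _ n2); exists (a^T *m b - b^T *m a); split.
- split=> [|i]; first by rewrite linearB /= !trmx_mul !trmxK opprB.
  by rewrite !mxE !big_ord1 !mxE mulrC subrr.
- rewrite mulmxBr mulmxBl !mulmxA -!trmx_mul -!mulmxA bC aC; apply/matrixP => i j.
  by rewrite !mxE !big_ord1 !mxE -xy1; ring.
(* If [a^T b = b^T a], multiplying by [C] on the right and comparing diagonal entries gives
   [y (a_i^2 + b_i^2) = 0] for every [i], so [v = 0]. *)
apply/eqP => /eqP; rewrite subr_eq0 => /eqP /(congr1 (mulmx^~ C)).
rewrite -!mulmxA bC aC => /matrixP abC.
have {}abC i : a 0 i = 0 /\ b 0 i = 0.
  have := abC i i; rewrite !mxE !big_ord1 !mxE => /eqP.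
  rewrite -subr_eq0 => /eqP e.
  have {}e : y * (a 0 i ^+ 2 + b 0 i ^+ 2) = 0 by rewrite -[RHS]e; ring.
  move/eqP: e; rewrite mulf_eq0 (negbTE y0) /= paddr_eq0 ?sqr_ge0 // !sqrf_eq0.
  by case/andP => /eqP-> /eqP->.
by apply: ab0; apply/rowP => i; rewrite mxE; have [] := abC i.
Qed.

End RealParts.

(** * Bounds on polynomials outside the open unit disk *)

Section RootBounds.
Variables (K : numFieldType) (z : K).
Implicit Type s : seq K.

(** This bound depends on the number of roots only, so it passes to limits of stable matrices. *)
Lemma ler_norm_prod_XsubC s : (forall y, y \in s -> `|y| < 1) -> 1 <= `|z| ->
  (`|z| - 1) ^+ size s <= `|(\prod_(y <- s) ('X - y%:P)).[z]|.
Proof.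
move=> s1 z1; elim: s s1 => [|y s IH] s1; first by rewrite big_nil hornerC normr1.
rewrite big_cons hornerM normrM exprS ler_pM ?exprn_ge0 ?subr_ge0 //.
  rewrite !hornerE (le_trans _ (lerB_dist _ _)) // lerD2l lerN2.
  by rewrite ltW // s1 ?mem_head.
by apply: IH => x xs; rewrite s1 // inE xs orbT.
Qed.

(** Each factor satisfies [|z - y| >= |z| - |y| >= |z| (1 - |y|)]. Growth like [|z|^n] is what makes
    the perturbation argument uniform in the unbounded variable [z]. *)
Lemma ler_norm_prod_XsubC_scaled s : (forall y, y \in s -> `|y| < 1) -> 1 <= `|z| ->
  `|z| ^+ size s * \prod_(y <- s) (1 - `|y|) <= `|(\prod_(y <- s) ('X - y%:P)).[z]|.
Proof.
move=> s1 z1; elim: s s1 => [|y s IH] s1.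
  by rewrite !big_nil hornerC normr1 mulr1.
have y1 : `|y| < 1 by rewrite s1 ?mem_head.
have {}s1 x : x \in s -> `|x| < 1 by move=> xs; rewrite s1 // inE xs orbT.
rewrite !big_cons hornerM normrM exprS mulrACA ler_pM ?IH //.
- by rewrite mulr_ge0 ?subr_ge0 // ltW.
- rewrite mulr_ge0 ?exprn_ge0 // big_seq prodr_ge0 // => x xs.
  by rewrite subr_ge0 ltW ?s1.
rewrite !hornerE (le_trans _ (lerB_dist _ _)) // mulrBr mulr1 lerD2l lerN2.
by rewrite ler_peMl.
Qed.

Lemma ler_dist_horner (n : nat) (p q : {poly K}) :
    (size p <= n.+1)%N -> (size q <= n.+1)%N -> 1 <= `|z| ->
  `|p.[z] - q.[z]| <= `|z| ^+ n * \sum_(i < n.+1) `|p`_i - q`_i|.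
Proof.
move=> sp sq z1; rewrite (horner_coef_wide z sp) (horner_coef_wide z sq) -sumrB.
rewrite (le_trans (ler_norm_sum _ _ _)) // mulr_sumr ler_sum // => i _.
by rewrite -mulrBl normrM normrX mulrC ler_wpM2r // ler_weXn2l // -ltnS.
Qed.

End RootBounds.

Lemma sum_poly_cont (R : rcfType) (m : nat) (F : nat -> {poly R}) (x e : R) : 0 < e ->
  exists2 d, 0 < d & forall y, `|y - x| < d -> \sum_(i < m) `|(F i).[y] - (F i).[x]| < e.
Proof.
elim: m e => [|m IH] e e0; first by exists 1 => // y _; rewrite big_ord0.
have e2 : 0 < e / 2%:R by rewrite divr_gt0 ?ltr0n.
have [d1 d10 H1] := IH _ e2; have [d2 d20 H2] := poly_cont x (F m) e2.
exists (Num.min d1 d2); first by rewrite lt_min d10.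
move=> y; rewrite lt_min => /andP[/H1 y1 /H2 y2].
by rewrite big_ord_recr /= [e]splitr ltrD.
Qed.

(** * Continuity of stability along the segment *)

Section Segment.
Variables (R : realType) (n : nat) (A1 A2 : 'M[R]_n).

Definition seg_mx (a : R) : 'M[R]_n := a *: A1 + (1 - a) *: A2.

Let chi a := char_poly (map_mx (real_complex R) (seg_mx a)).

Lemma char_poly_seg_mx_cont (a e : R) : 0 < e ->
  exists2 d, 0 < d & forall b, `|b - a| < d -> forall z : R[i], 1 <= `|z| ->
    `|(chi b).[z] - (chi a).[z]| < `|z| ^+ n * real_complex R e.
Proof.
move=> e0.
(* The segment parameter becomes the inner indeterminate: each coefficient of [P] is a polynomial in
   it, hence continuous. *)
pose P : {poly {poly R}} :=
  char_poly ('X *: map_mx polyC A1 + (1 - 'X) *: map_mx polyC A2).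
have chiE b : chi b = map_poly (real_complex R) (map_poly (horner_eval b) P).
  rewrite /chi /P !map_char_poly; congr (char_poly (map_mx _ _)).
  by apply/matrixP => i j; rewrite !mxE /= /horner_eval !hornerE.
have [d d0 dP] := sum_poly_cont n.+1 (fun i => P`_i) a e0.
exists d => // b /dP bd z z1.
have schi c : (size (chi c) <= n.+1)%N by rewrite size_char_poly.
apply: (le_lt_trans (ler_dist_horner (schi b) (schi a) z1)).
rewrite ltr_pM2l ?exprn_gt0 ?(lt_le_trans ltr01) //.
rewrite (_ : \sum_(i < _) _ = real_complex R (\sum_(i < n.+1) `|(P`_i).[b] - (P`_i).[a]|)).
  by rewrite ltcR.
rewrite rmorph_sum; apply: eq_bigr => i _.
rewrite !chiE !coef_map /= /horner_eval -rmorphB normc_def /=.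
by rewrite expr0n addr0 sqrtr_sqr.
Qed.

Lemma schur_stable_roots (A : 'M[R]_n) : schur_stable A ->
  exists s : seq R[i], [/\ size s = n, forall y, y \in s -> `|y| < 1 &
    char_poly (map_mx (real_complex R) A) = \prod_(y <- s) ('X - y%:P)].
Proof.
move=> sA; have [s] := closed_field_poly_normal (char_poly (map_mx (real_complex R) A)).
rewrite (monicP (char_poly_monic _)) scale1r => sE; exists s; split=> //.
  by have := size_char_poly (map_mx (real_complex R) A); rewrite sE size_prod_XsubC => -[].
by move=> y ys; apply: sA; rewrite eigenvalue_root_char sE root_prod_XsubC.
Qed.

Lemma complex_pos_real (c : R[i]) : 0 < c ->
  exists2 e : R, 0 < e & real_complex R e = c.
Proof.
move=> c0; exists (complex.Re c); last by rewrite RRe_real // gtr0_real.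
by move: c0; rewrite ltcE => /andP[].
Qed.

(** Outside the open disk [chi a] is at least [c |z|^n] in modulus, with [c] the product of the
    [1 - |y|] over its roots. A perturbation smaller than this leaves no zero there. *)
Lemma schur_stable_near (a : R) : schur_stable (seg_mx a) ->
  exists2 d, 0 < d & forall b, `|b - a| < d -> schur_stable (seg_mx b).
Proof.
move=> sa; have [s [ss s1 sE]] := schur_stable_roots sa.
have c0 : 0 < \prod_(y <- s) (1 - `|y|).
  by rewrite big_seq prodr_gt0 // => y /s1; rewrite subr_gt0.
have [e e0 ce] := complex_pos_real c0.
have [d d0 dP] := char_poly_seg_mx_cont a e0.
exists d; first exact: d0.
move=> b /dP bd z zb_eigen.
have zb : (chi b).[z] = 0 by apply/rootP; rewrite -eigenvalue_root_char.
rewrite real_ltNge ?normr_real ?real1 //; apply/negP => z1.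
have := ler_norm_prod_XsubC_scaled s1 z1; rewrite -sE ss -ce.
move=> /le_lt_trans lt_chi; have := bd z z1.
by rewrite zb sub0r normrN => /lt_chi; rewrite ltxx.
Qed.

(** A zero [z] of [chi a] with [|z| > 1] is impossible: nearby stable matrices give [|(chi b).[z]|
    >= (|z| - 1)^n], contradicting continuity at [z]. *)
Lemma schur_stable_closed (a : R) :
    (forall z : R[i], eigenvalue (map_mx (real_complex R) (seg_mx a)) z -> `|z| != 1) ->
    (forall d, 0 < d -> exists2 b, `|b - a| < d & schur_stable (seg_mx b)) ->
  schur_stable (seg_mx a).
Proof.
move=> a1 aP z za; have := a1 z za.
rewrite real_ltNge ?normr_real ?real1 // => zn1; apply/negP => z1.
have {zn1} z1' : 1 < `|z| by rewrite lt_neqAle eq_sym zn1.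
have zn0 : 0 < `|z| ^+ n by rewrite exprn_gt0 ?(lt_trans ltr01).
(* The division offsets the factor [|z|^n] in the continuity estimate. *)
have c0 : 0 < (`|z| - 1) ^+ n / `|z| ^+ n.
  by apply: divr_gt0 zn0; apply: exprn_gt0; rewrite subr_gt0.
have [e e0 ce] := complex_pos_real c0.
have [d /aP[b bd sb] dP] := char_poly_seg_mx_cont a e0.
have [s [ss s1 sE]] := schur_stable_roots sb.
have := ler_norm_prod_XsubC s1 z1; rewrite -sE ss.
have := dP b bd z z1; rewrite ce mulrC divfK ?gt_eqF //.
have -> : (chi a).[z] = 0 by apply/rootP; rewrite -eigenvalue_root_char.
by rewrite subr0 => /lt_le_trans h /h; rewrite ltxx.
Qed.

(** A connectedness argument: the supremum [t] of the parameters up to which stability holds is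
    attained by closedness, and by openness it cannot be less than 1. *)
Lemma schur_stable_segment : schur_stable A2 ->
    (forall a, 0 <= a <= 1 -> forall z : R[i],
       eigenvalue (map_mx (real_complex R) (seg_mx a)) z -> `|z| != 1) ->
  forall a, 0 <= a <= 1 -> schur_stable (seg_mx a).
Proof.
move=> s2 circ.
pose S : classical_sets.set R := fun t =>
  0 <= t <= 1 /\ forall b, 0 <= b <= t -> schur_stable (seg_mx b).
have S0 : S 0.
  split=> [|b]; first by rewrite lexx ler01.
  by rewrite -eq_le => /eqP<-; rewrite /seg_mx scale0r add0r subr0 scale1r.
have ubS : classical_sets.ubound S 1 by move=> t [/andP[]].
have hS : classical_sets.has_sup S by split; [exists 0|exists 1].
set t := sup S.
have t0 : 0 <= t by apply: (sup_upper_bound hS).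
have t1 : t <= 1 by apply: ge_sup ubS; exists 0.
have below b : 0 <= b < t -> schur_stable (seg_mx b).
  move=> /andP[b0 bt]; have [|c [_ cS]] := @sup_adherent _ S (t - b) _ hS.
    by rewrite subr_gt0.
  by rewrite subKr => bc; apply: cS; rewrite b0 ltW.
have st : schur_stable (seg_mx t).
  apply: schur_stable_closed; first by apply: circ; rewrite t0.
  move=> d d0; have [c Sc tc] := sup_adherent d0 hS.
  have ct : c <= t by apply: (sup_upper_bound hS).
  have [/andP[c0 _] cS] := Sc.
  exists c; last by apply: cS; rewrite c0 lexx.
  by rewrite ler0_norm ?subr_le0 // opprB ltrBlDr -ltrBlDl.
have St : S t.
  split=> [|b /andP[b0]]; first by rewrite t0.
  by rewrite le_eqVlt => /orP[/eqP->//|bt]; apply: below; rewrite b0.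
have [d d0 dP] := schur_stable_near st.
suff tE : t = 1 by move=> a; have [_] := St; rewrite tE; apply.
apply/eqP; rewrite eq_le t1 leNgt; apply/negP => lt1.
(* Half of [d] keeps [[t, u]] strictly inside the stable neighbourhood of [t]. *)
set u := Num.min 1 (t + d / 2%:R).
have d2 : 0 < d / 2%:R by rewrite divr_gt0 ?ltr0n.
have tu : t < u by rewrite lt_min lt1 ltrDl.
suff /(sup_upper_bound hS) : S u by rewrite leNgt tu.
split=> [|b /andP[b0 bu]]; first by rewrite (le_trans t0 (ltW tu)) ge_min lexx.
have [bt|tb] := ltP b t; first by apply: below; rewrite b0.
apply: dP; rewrite ger0_norm ?subr_ge0 // ltrBlDl (le_lt_trans bu) //.
by rewrite gt_min [X in _ || X]ltrD2l ltr_pdivrMr ?ltr0n // ltr_pMr // ltr1n orbT.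
Qed.

End Segment.

(** * Eigenvalues 1 and -1 on the segment, and the pencils of (i) *)

Lemma unitmx_opp (R : comUnitRingType) (n : nat) (A : 'M[R]_n) :
  (- A \in unitmx) = (A \in unitmx).
Proof. by rewrite -scaleN1r unitmxZ // unitrN1. Qed.

Lemma seg_mx_oppr (R : realType) (n : nat) (A1 A2 : 'M[R]_n) (a : R) :
  seg_mx (- A1) (- A2) a = - seg_mx A1 A2 a.
Proof. by rewrite /seg_mx !scalerN -opprD. Qed.

Lemma eigenvalue_opp (F : fieldType) (n : nat) (A : 'M[F]_n) (a : F) :
  eigenvalue (- A) a = eigenvalue A (- a).
Proof.
by rewrite !eigenvalueNunitmx raddfN opprK -opprD unitmx_opp.
Qed.

(* For [x < 0] and [a = 1 / (1 - x)], the matrices [(I - A1) - x (I - A2)] and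
   [I - (a A1 + (1 - a) A2)] are proportional. *)
Lemma eigenvalue_pencil (R : realType) (n : nat) (A1 A2 : 'M[R]_n) :
    ~~ eigenvalue A2 1 ->
  (exists2 x : R, x < 0 & eigenvalue ((1%:M - A1) *m invmx (1%:M - A2)) x) <->
  (exists2 a : R, 0 < a < 1 & eigenvalue (seg_mx A1 A2 a) 1).
Proof.
rewrite eigenvalueNunitmx negbK -unitmx_opp opprB => u2.
(* The left eigenvectors are the same on both sides. *)
have key x (v : 'rV[R]_n) : x != 1 ->
    (v *m ((1%:M - A1) *m invmx (1%:M - A2)) = x *: v) <->
    (v *m seg_mx A1 A2 (1 - x)^-1 = 1 *: v).
  move=> x1; have x1' : 1 - x != 0 by rewrite subr_eq0 eq_sym.
  transitivity (v *m (1%:M - A1) = x *: (v *m (1%:M - A2))).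
    split=> [/(congr1 (mulmx^~ (1%:M - A2)))|e].
      by rewrite -mulmxA mulmxKV // scalemxAl.
    by rewrite mulmxA e -scalemxAl mulmxK.
  rewrite /seg_mx !mulmxBr !mulmx1 scale1r mulmxDr -!scalemxAr.
  move: (v *m A1) (v *m A2) => p q.
  split=> e; apply/rowP => k; move/rowP: e => /(_ k); rewrite !mxE => e.
    by have -> : p 0 k = v 0 k - x * (v 0 k - q 0 k); [rewrite -e; ring | field].
  by rewrite -e; field.
split=> [[x x0 /eigenvalueP[v vx v0]]|[a /andP[a0 a1] /eigenvalueP[v va v0]]].
  have x1 : x != 1 by rewrite lt_eqF // (lt_trans x0).
  have x1' : 1 < 1 - x by rewrite ltrDl oppr_gt0.
  exists (1 - x)^-1; first by rewrite invr_gt0 invf_lt1 ?(lt_trans ltr01) ?x1'.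
  by apply/eigenvalueP; exists v => //; apply/key.
(* This solves [a = 1 / (1 - x)] for [x]. *)
exists (1 - a^-1); first by rewrite subr_lt0 invf_gt1.
apply/eigenvalueP; exists v => //; apply/key; last by rewrite subKr invrK.
by rewrite lt_eqF // ltrBlDr ltrDl invr_gt0.
Qed.

(** * The quadratic matrix polynomial and its companion matrix *)

(** The bialternate product is bilinear and symmetric, so the square of [A2 + a (A1 - A2)] expands
    as a quadratic in [a]. *)
Lemma seg_bialternate (R : realType) (n : nat) (A1 A2 : 'M[R]_n) (a : R) :
  segF0 A2 + a *: segF1 A1 A2 + a ^+ 2 *: segF2 A1 A2 =
  1%:M - bialternate (seg_mx A1 A2 a) (seg_mx A1 A2 a).
Proof.
rewrite /segF0 /segF1 /segF2.
apply/matrixP => r c; rewrite !mxE.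
case: (ltpair r) => i j; case: (ltpair c) => k l.
by rewrite /det2 !mxE; field.
Qed.

Lemma eigenvalue_segM (R : realType) (n : nat) (A1 A2 : 'M[R]_n) (x : R) :
    ~~ eigenvalue (bialternate A2 A2) 1 -> x != 0 ->
  eigenvalue (segM A1 A2) x <->
  eigenvalue (bialternate (seg_mx A1 A2 x^-1) (seg_mx A1 A2 x^-1)) 1.
Proof.
rewrite eigenvalueNunitmx negbK -unitmx_opp opprB -/(segF0 A2) => u0 x0.
(* With [a = 1 / x], multiplying by [x^2] gives [w (x^2 F0 + x F1 + F2) = 0], the form that [segM]
   linearizes. *)
have key (w : 'rV[R]_(bialt_dim n)) :
    (w *m bialternate (seg_mx A1 A2 x^-1) (seg_mx A1 A2 x^-1) = 1 *: w) <->
    (- (w *m segF2 A1 A2) - x *: (w *m segF1 A1 A2) = x ^+ 2 *: (w *m segF0 A2)).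
  transitivity (w *m (1%:M - bialternate (seg_mx A1 A2 x^-1) (seg_mx A1 A2 x^-1)) = 0).
    rewrite mulmxBr mulmx1 scale1r; split=> [->|/eqP]; first by rewrite subrr.
    by rewrite subr_eq0 => /eqP.
  rewrite -seg_bialternate; move: (segF0 A2) (segF1 A1 A2) (segF2 A1 A2) => F0 F1 F2.
  rewrite !mulmxDr -!scalemxAr.
  split=> [/(congr1 ( *:%R (x ^+ 2)))|e].
    rewrite scaler0 !scalerDr !scalerA => /eqP.
    rewrite -exprMn mulfV // expr1n scale1r.
    rewrite (_ : x ^+ 2 / x = x); last by field.
    by rewrite -addrA addr_eq0 => /eqP ->; rewrite opprD addrC.
  apply: (@scalerI _ _ (x ^+ 2)); first by rewrite expf_neq0.
  rewrite scaler0 !scalerDr !scalerA -exprMn mulfV // expr1n scale1r.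
  rewrite (_ : x ^+ 2 / x = x); last by field.
  by rewrite -e addrNK addNr.
split=> /eigenvalueP[v vE v0]; apply/eigenvalueP.
  rewrite -[v]hsubmxK /segM mul_row_block mulmx0 add0r mulmx1 scale_row_mx in vE.
  have [v1E v2E] := eq_row_mx vE.
  set v1 := lsubmx v in vE v1E v2E; set v2 := rsubmx v in vE v1E v2E.
  (* The blocks of [v M = x v] read [x v1 = - w F2] and [x v2 = v1 - w F1] with [w = v2 F0^-1];
     eliminating [v1] gives the quadratic equation for [w]. *)
  exists (v2 *m invmx (segF0 A2)).
    apply/key; rewrite mulmxKV //.
    rewrite mulmxN mulmxA in v1E; rewrite mulmxN mulmxA in v2E.
    by rewrite v1E expr2 -scalerA -v2E scalerBr.
  apply: contraNneq v0 => w0.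
  have v20 : v2 = 0 by rewrite -[v2](mulmxKV u0) w0 mul0mx.
  have v10 : v1 = 0.
    by apply: (scalerI x0); rewrite -v1E v20 mul0mx scaler0.
  by rewrite -[v]hsubmxK -/v1 -/v2 v10 v20 row_mx0.
(* The same block equations solved for [v1] and [v2], with [v] as [w]. *)
exists (row_mx (- (x^-1 *: (v *m segF2 A1 A2))) (v *m segF0 A2)).
  rewrite /segM mul_row_block mulmx0 add0r mulmx1 scale_row_mx.
  have cancel F : v *m segF0 A2 *m - (invmx (segF0 A2) *m F) = - (v *m F).
    by rewrite mulmxN mulmxA mulmxK.
  rewrite !cancel.
  congr row_mx; first by rewrite scalerN scalerA mulfV // scale1r.
  move/key: vE => vE; apply: (scalerI x0); rewrite [RHS]scalerA -expr2 -vE.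
  by rewrite scalerDr !scalerN scalerA mulfV // scale1r.
apply: contraNneq v0 => /eqP; rewrite row_mx_eq0 => /andP[_ /eqP e].
by rewrite -[v](mulmxK u0) e mul0mx.
Qed.

(** * Conditions (i) and (ii) against the unit circle *)

Lemma schur_stable_no_real_unit (R : realType) (n : nat) (A : 'M[R]_n) (a : R) :
  `|a| = 1 -> schur_stable A -> ~~ eigenvalue A a.
Proof.
move=> a1 sA; rewrite -(eigenvalue_map (real_complex R)); apply/negP => /sA.
rewrite normc_def /= expr0n addr0 sqrtr_sqr a1.
by rewrite -[1%:C%C]/(real_complex R 1) rmorph1 ltxx.
Qed.

Theorem theorem2p8 (R : realType) (n : nat) (A1 A2 : 'M[R]_n)
    (hA1 : schur_stable A1) (hA2 : schur_stable A2) :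
  (forall alpha : R, 0 <= alpha <= 1 ->
     schur_stable (alpha *: A1 + (1 - alpha) *: A2))
  <->
  ((~ exists2 x : R, x < 0 &
        eigenvalue ((1%:M - A1) *m invmx (1%:M - A2)) x) /\
   (~ exists2 x : R, x < 0 &
        eigenvalue ((1%:M + A1) *m invmx (1%:M + A2)) x)) /\
  (~ exists2 x : R, 1 <= x & eigenvalue (segM A1 A2) x).
Proof.
have e2 := schur_stable_no_real_unit (normr1 R) hA2.
have e2' : ~~ eigenvalue (- A2) 1.
  by rewrite eigenvalue_opp (schur_stable_no_real_unit (normrN1 R) hA2).
have pencil1 := eigenvalue_pencil A1 e2.
(* Eigenvalue -1 of [C(a)] is eigenvalue 1 of [- C(a)], the segment between [- A1] and [- A2]. *)
have pencilN1 := eigenvalue_pencil (- A1) e2'.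
rewrite !opprK in pencilN1.
have segM_eigen := @eigenvalue_segM R n A1 A2 _ (schur_stable_bialternate hA2).
have inv01 (x : R) : 1 <= x -> 0 < x^-1 <= 1.
  by move=> x1; have x0 := lt_le_trans ltr01 x1; rewrite invr_gt0 x0 invf_le1.
split=> [stable|[[no1 noN1] noM]].
  split; first split.
  - move=> /pencil1[a /andP[/ltW a0 /ltW a1]]; apply/negP.
    apply: (schur_stable_no_real_unit (normr1 R)); apply: stable.
    by rewrite a0.
  - move=> /pencilN1[a /andP[/ltW a0 /ltW a1]]; rewrite seg_mx_oppr eigenvalue_opp.
    apply/negP; apply: (schur_stable_no_real_unit (normrN1 R)); apply: stable.
    by rewrite a0.
  move=> [x x1]; rewrite segM_eigen ?gt_eqF ?(lt_le_trans ltr01) //; apply/negP.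
  have /andP[/ltW x0 x1'] := inv01 x x1.
  by apply: schur_stable_bialternate; apply: stable; rewrite x0.
apply: (schur_stable_segment hA2) => a /andP[a0 a1] z za; apply/eqP => z1.
(* The pencils only see [0 < a < 1]; at the endpoints the stability of [A2] and [A1] excludes
   [|z| = 1]. *)
have [a00|an0] := eqVneq a 0.
  by have := hA2 z; rewrite -z1 ltxx => h; apply/notF/h; move: za;
    rewrite a00 /seg_mx scale0r add0r subr0 scale1r.
have [a11|an1] := eqVneq a 1.
  by have := hA1 z; rewrite -z1 ltxx => h; apply/notF/h; move: za;
    rewrite a11 /seg_mx subrr scale0r addr0 scale1r.
have a01 : 0 < a < 1 by rewrite !lt_neqAle eq_sym an0 a0 an1.
have [ea|ea|ea] := eigenvalue_unit_circle za z1.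
- by apply/no1/pencil1; exists a.
- by apply/noN1/pencilN1; exists a => //; rewrite seg_mx_oppr eigenvalue_opp.
apply: noM; exists a^-1; first by rewrite invf_ge1 // lt_neqAle eq_sym an0.
by apply/segM_eigen; rewrite ?invr_eq0 // invrK.
Qed.
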